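(* Let $(\pi,V)$ be a representation of a Banach--Lie group $G$ on a Banach space $V$ for which the corresponding action $G\times V\to V$, $(g,v)\mapsto\pi(g)v$, is continuous. Then $\mathcal D_{\mathfrak g}$ coincides with the space of $C^1$-vectors.
   Context: A Banach--Lie group is a Lie group modeled on a Banach space; $\mathfrak g$ is its Lie algebra and $\exp_G:\mathfrak g\to G$ its exponential function. For $x\in\mathfrak g$ let $$\mathcal D_x:=\Big\{v\in V:\ \tfrac{d}{dt}\Big|_{t=0}\pi(\exp_G(tx))v\ \text{exists}\Big\},\qquad \mathcal D_{\mathfrak g}:=\bigcap_{x\in\mathfrak g}\mathcal D_x.$$ A vector $v\in V$ is a $C^1$-vector if the orbit map $\pi^v:G\to V$, $g\mapsto\pi(g)v$, is a $C^1$-map. Here a map $f:U\to F$ ($U\subseteq E$ open, $E,F$ locally convex spaces) is $C^1$ if all directional derivatives $\mathrm{d}f(x)(h)=\lim_{t\to0}\frac1t(f(x+th)-f(x))$ exist for $x\in U$, $h\in E$, and $f$ and $\mathrm{d}f:U\times E\to F$ are continuous (this is weaker than continuous Fréchet differentiability with respect to the operator norm); the notion is transferred to $G$ by charts. *)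

(* Defs.v *)
From HB Require Import structures.
From mathcomp Require Import all_boot all_order all_algebra.
From mathcomp Require Import all_classical all_reals all_analysis.
Set Implicit Arguments.
Unset Strict Implicit.
Unset Printing Implicit Defensive.
Import Order.TTheory GRing.Theory Num.Theory.
Import numFieldNormedType.Exports.
Local Open Scope classical_set_scope.
Local Open Scope ring_scope.

(* C^k in the Michal-Bastiani sense: f is C^(k+1) on U when it is continuous,
   all directional derivatives exist, and df : U x E -> F is C^k.  In
   particular [Ck_on 1 U f] says: f continuous, df exists and is continuous on
   U x E.  The notion is meant for (and only used with) open sets U; f is a
   total function, but its values outside U play no role. *)
Fixpoint Ck_on (R : realType) (k : nat) (E F : normedModType R)
    (U : set E) (f : E -> F) {struct k} : Prop :=
  match k with
  | 0%N => {within U, continuous f}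
  | k'.+1 => [/\ {within U, continuous f},
      forall x h, U x -> derivable f x h
    & @Ck_on R k' (E * E)%type F (U `*` setT) (fun p => 'D_(p.2) f p.1)]
  end.

Definition smooth_on (R : realType) (E F : normedModType R)
    (U : set E) (f : E -> F) : Prop := forall k, Ck_on k U f.

(* A homeomorphism from an open subset of G onto an open subset of E. The maps
   are totalised: values of chart_fun outside chart_dom, and of chart_inv
   outside the image, are irrelevant. *)
Record chart (R : realType) (E : normedModType R) (G : topologicalType) :=
  Chart {
    chart_dom : set G;
    chart_fun :> G -> E;
    chart_inv : E -> G;
    chart_dom_open : open chart_dom;
    chart_im_open : open (chart_fun @` chart_dom);
    chart_funK : {in chart_dom, cancel chart_fun chart_inv};
    chart_fun_continuous : {within chart_dom, continuous chart_fun};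
    chart_inv_continuous :
      {within chart_fun @` chart_dom, continuous chart_inv} }.

Definition chart_im (R : realType) (E : normedModType R) (G : topologicalType)
    (c : chart E G) : set E := c @` chart_dom c.

HB.mixin Record isBanachLieGroup (R : realType) (E : completeNormedModType R)
    G of Topological G & Group G := {
  lie_hausdorff : hausdorff_space G;
  atlas : set (chart E G);
  atlas_cover : forall g : G, exists2 c, atlas c & chart_dom c g;
  atlas_compat : forall c d, atlas c -> atlas d ->
    smooth_on (c @` (chart_dom c `&` chart_dom d)) (d \o chart_inv c);
  lie_mul_continuous : continuous (fun p : G * G => (p.1 * p.2)%g);
  lie_mul_smooth : forall c d e, atlas c -> atlas d -> atlas e ->
    smooth_on
      [set p : E * E | [/\ chart_im c p.1, chart_im d p.2
        & chart_dom e (chart_inv c p.1 * chart_inv d p.2)%g]]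
      (fun p => e (chart_inv c p.1 * chart_inv d p.2)%g);
  lie_inv_continuous : continuous (fun g : G => (g^-1)%g);
  lie_inv_smooth : forall c d, atlas c -> atlas d ->
    smooth_on
      [set x : E | chart_im c x /\ chart_dom d ((chart_inv c x)^-1)%g]
      (fun x => d ((chart_inv c x)^-1)%g) }.

#[short(type="banachLieGroupType")]
HB.structure Definition BanachLieGroup (R : realType)
    (E : completeNormedModType R) :=
  {G of Topological G & Group G & isBanachLieGroup R E G}.

(* The Lie algebra T_1(G) is identified, as a topological vector space, with
   the model space E by means of the tangent map at 1 of a chart c0 around 1:
   x : E stands for the tangent vector whose coordinate in c0 is x.  (The
   bracket is not needed.)  An exponential function is a smooth map
   expG : T_1(G) -> G such that, for every x, t |-> expG (t x) is a
   one-parameter group with velocity x at t = 0; it is unique. *)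
Record exponential_function (R : realType) (E : completeNormedModType R)
    (G : banachLieGroupType E) (c0 : chart E G) (expG : E -> G) : Prop := {
  exp_continuous : continuous expG;
  exp_smooth : forall c : chart E G, atlas c ->
    smooth_on (expG @^-1` chart_dom c) (c \o expG);
  exp_one_param : forall (x : E) (s t : R),
    expG ((s + t) *: x) = (expG (s *: x) * expG (t *: x))%g;
  exp_velocity : forall x : E,
    is_derive (0 : R) 1 (fun t : R => c0 (expG (t *: x))) x }.

Record representation (R : realType) (E : completeNormedModType R)
    (G : banachLieGroupType E) (V : normedModType R)
    (pi : G -> {linear V -> V}) : Prop := {
  repr1 : forall v, pi 1%g v = v;
  reprM : forall (g h : G) v, pi (g * h)%g v = pi g (pi h v) }.

Section DifferentiableVectors.
Context (R : realType) (E : completeNormedModType R) (G : banachLieGroupType E).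
Context (V : normedModType R) (pi : G -> {linear V -> V}).

Definition D_at (expG : E -> G) (x : E) : set V :=
  [set v | derivable (fun t : R => pi (expG (t *: x)) v) 0 1].

Definition D_Lie (expG : E -> G) : set V := \bigcap_(x in setT) D_at expG x.

Definition C1_map (f : G -> V) : Prop :=
  forall c : chart E G, atlas c -> Ck_on 1 (chart_im c) (f \o chart_inv c).

Definition C1_vectors : set V := [set v | C1_map (fun g => pi g v)].

End DifferentiableVectors.

(* Main.v *)
(* Write [p0 = c0 1] and [m] for the multiplication read in the chart [c0].  Let
   [v] be in [D_Lie].  By Baire, there are a ball around some [a : E] and [K]
   with [|pi (exp (t x)) v - v| <= K |t|] for all [x] in the ball and all small
   [t].  For small [s > 0] the elements [exp (- s a) exp (s x)], with [x] in this
   ball, fill a ball of radius proportional to [s] around [p0] in the chart, so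
   the orbit map of [v] is Lipschitz at [1].  Hence two curves through [1] with
   the same velocity [x] give the same derivative of the orbit map, namely that
   of [t |-> pi (exp (t x)) v]; in particular this derivative is additive in [x]
   and, being Lipschitz, continuous in [x].  Translating by group elements
   yields the derivatives of the orbit map everywhere.
   Maps that are C^2 in the Michal-Bastiani sense are strictly differentiable,
   which gives the estimates on [m] and [exp]; the filling argument is then the
   Banach fixed point theorem. *)
Require Import Defs.
From HB Require Import structures.
From mathcomp Require Import all_boot all_order all_algebra.
From mathcomp Require Import all_classical all_reals all_analysis.
From mathcomp Require Import ring lra.
Import Order.TTheory GRing.Theory Num.Theory.
Import numFieldNormedType.Exports.
Local Open Scope classical_set_scope.
Local Open Scope ring_scope.

(** * Differential calculus in normed spaces: mean value estimates, strict differentiability, local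
    surjectivity *)

Section Calculus.
Set Implicit Arguments.
Unset Strict Implicit.
Context {R : realType}.
Implicit Types E V : normedModType R.

Lemma near_normP E (x : E) (P : set E) :
  (\forall y \near x, P y) <->
  exists2 d : R, 0 < d & forall y, `|y - x| < d -> P y.
Proof.
split=> [/nbhs_ballP[d /= d0 dP]|[d d0 dP]].
  by exists d => // y yx; apply: dP; rewrite -ball_normE/= distrC.
apply/nbhs_ballP; exists d => //= y; rewrite -ball_normE/= distrC; exact: dP.
Qed.

(** This form of the limit has no division and includes [t = 0], so error bounds can be added and
    composed directly. *)
Lemma is_deriveP E V (f : E -> V) (a h : E) (w : V) :
  is_derive a h f w <-> forall e : R, 0 < e ->
    \forall t \near (0 : R), `|f (a + t *: h) - f a - t *: w| <= e * `|t|.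
Proof.
split=> [[df <-] e e0|df].
  have /eqaddoP/(_ e e0) := derivable_nbhs df; apply: filterS => t /=.
  by rewrite opprD addrA (addrC a).
have cvgw :
    (fun t : R => t^-1 *: ((f \o shift a) (t *: h) - f a)) @ 0^' --> w.
  apply/cvgrPdist_le => e e0.
  rewrite near_withinE; near=> t => t0.
  have -> : w = t^-1 *: (t *: w) by rewrite scalerA mulVf// scale1r.
  rewrite -scalerBr normrZ normfV ler_pdivrMl ?normr_gt0// mulrC distrC /=.
  by rewrite (addrC _ a); near: t; apply: df.
by split; [apply/cvg_ex; exists w | exact: cvg_lim].
Unshelve. all: by end_near. Qed.

(* A left-to-right continuity argument replaces the fundamental theorem of
   calculus, as no integral of vector-valued functions is available. *)
Lemma norm_increment_le V (f f' : R -> V) (M : R) :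
  (forall t : R, 0 <= t <= 1 -> is_derive t 1 f (f' t)) ->
  (forall t : R, 0 <= t <= 1 -> `|f' t| <= M) -> `|f 1 - f 0| <= M.
Proof.
move=> df f'M; apply/ler_addgt0Pr => e e0; set L := M + e.
pose S := [set t | 0 <= t <= 1 /\ `|f t - f 0| <= L * t].
have loc s : 0 <= s <= 1 -> exists2 d, 0 < d &
    forall t, `|t - s| < d -> `|f t - f s| <= L * `|t - s|.
  move=> s01; have /is_deriveP/(_ e e0) := df s s01.
  move=> /near_normP[d d0 dP]; exists d => // t ts.
  have := dP (t - s); rewrite subr0 => /(_ ts).
  have -> : s + (t - s) *: 1 = t by rewrite [(t - s) *: 1]mulr1 addrC subrK.
  move=> A; rewrite /L mulrDl [leRHS]addrC -[f t - f s](subrK ((t - s) *: f' s)).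
  apply: le_trans (ler_normD _ _) _; apply: lerD => //.
  by rewrite normrZ mulrC; apply: ler_wpM2r => //; exact: f'M.
have S0 : S 0 by split; [rewrite lexx ler01 | rewrite subrr normr0 mulr0].
have hS : has_sup S.
  by split; [exists 0|exists 1 => t [/andP[]]].
set s := sup S.
have s01 : 0 <= s <= 1.
  apply/andP; split; first exact: sup_upper_bound.
  by apply: ge_sup; [exists 0|move=> t [/andP[]]].
have [d d0 dP] := loc s s01.
have L_ge0 : 0 <= L by apply: addr_ge0 (ltW e0); apply: le_trans (f'M s s01).
have [t [t01 ft] st] := sup_adherent d0 hS.
have ts : t <= s by apply: sup_upper_bound.
(* The supremum belongs to [S]: a point [t] of [S] within [d] of [s] passes its bound on to [s]. *)
have Ss : S s.
  split=> //; rewrite -[f s - f 0](subrKA (f t)).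
  rewrite (le_trans (ler_normD _ _))//.
  have : `|f t - f s| <= L * `|t - s|.
    by apply: dP; rewrite distrC ger0_norm ?subr_ge0//;
      rewrite ltrBlDl -ltrBlDr.
  rewrite distrC (distrC t) ger0_norm ?subr_ge0// => A.
  by rewrite (le_trans (lerD A ft))// -mulrDr subrK.
have [s1|] := ltP s 1; last first.
  move=> s1; have <- : s = 1.
    by apply/eqP; rewrite eq_le s1; case/andP: s01 => _ ->.
  by case: Ss => _ /le_trans; apply; rewrite -[leRHS]mulr1 ler_wpM2l//;
    case/andP: s01.
(* If [s < 1], the local estimate at [s] puts the larger point [t'] into [S], against the choice of
   [s]. *)
pose t' := Num.min 1 (s + d / 2).
have st' : s < t' by rewrite lt_min s1 ltrDl divr_gt0.
have : S t'.
  have t's : `|t' - s| < d.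
    rewrite ger0_norm ?subr_ge0 ?(ltW st')// ltrBlDl.
    rewrite (@le_lt_trans _ _ (s + d / 2)) ?ge_min ?lexx ?orbT//.
    by rewrite ltrD2l gtr_pMr// invf_lt1// ltr1n.
  split.
    by rewrite ge_min lexx andbT (le_trans _ (ltW st'))//; case/andP: s01.
  rewrite -[f t' - f 0](subrKA (f s)) (le_trans (ler_normD _ _))//.
  case: Ss => _ A; rewrite (le_trans (lerD (dP _ t's) A))//.
  by rewrite ger0_norm ?subr_ge0 ?(ltW st')// -mulrDr subrK.
by move=> /(sup_upper_bound hS); rewrite leNgt st'.
Qed.

(** The mean value inequality for [s |-> f (p + s *: d) - s *: w], whose derivative is
    ['D_d f (p + s *: d) - w]. *)
Lemma segment_increment_le E V (f : E -> V) (p d : E) (w : V) (M : R) :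
  (forall s : R, 0 <= s <= 1 -> derivable f (p + s *: d) d) ->
  (forall s : R, 0 <= s <= 1 -> `|'D_d f (p + s *: d) - w| <= M) ->
  `|f (p + d) - f p - w| <= M.
Proof.
move=> df fM; pose g (s : R) := f (p + s *: d) - s *: w.
have -> : f (p + d) - f p - w = g 1 - g 0.
  by rewrite /g !scale1r !scale0r addr0 subr0 addrAC.
apply: (@norm_increment_le _ _ (fun s => 'D_d f (p + s *: d) - w)) => // s s01.
apply/is_deriveP => e e0.
have /is_deriveP/(_ e e0) : is_derive (p + s *: d) d f ('D_d f (p + s *: d)).
  by apply: DeriveDef => //; exact: df.
apply: filterS => t; rewrite /g [t *: 1]mulr1 scalerBr !scalerDl addrA.
set D := _ *: 'D_d f _.
rewrite opprB (opprB D) opprD !addrA.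
by rewrite (addrAC _ (- (t *: w)) (s *: w)) subrK
  (addrAC _ (- (t *: w)) (- f _)) subrK.
Qed.

Lemma is_derive_scale E V (f : E -> V) (a h : E) (w : V) (c : R) :
  is_derive a h f w -> is_derive a (c *: h) f (c *: w).
Proof.
have [->|c0] := eqVneq c 0; first by rewrite !scale0r => _; exact: is_derive0.
move=> /is_deriveP df; apply/is_deriveP => e e0.
have := df (e / `|c|); rewrite divr_gt0 ?normr_gt0// => /(_ isT).
move=> /near_normP[d d0 dP]; apply/near_normP; exists (d / `|c|).
  by rewrite divr_gt0 ?normr_gt0.
move=> t; rewrite !subr0 ltr_pdivlMr ?normr_gt0// => tc.
have := dP (t * c); rewrite subr0 normrM => /(_ tc).
by rewrite !scalerA [`|t| * _]mulrC mulrA divfK ?normr_eq0.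
Qed.

Lemma derive_scale E V (f : E -> V) (a h : E) (c : R) :
  derivable f a h -> 'D_(c *: h) f a = c *: 'D_h f a.
Proof.
by move=> df; apply: derive_val; apply: is_derive_scale; apply: DeriveDef.
Qed.

Lemma openX (S T : topologicalType) (A : set S) (B : set T) :
  open A -> open B -> open (A `*` B).
Proof.
move=> oA oB; rewrite openE => -[x y] /= [Ax By].
by exists (A, B) => //; split; apply: open_nbhs_nbhs.
Qed.

Lemma Ck_on_derive_continuous E V (U : set E) (f : E -> V) (x h : E) :
  open U -> Ck_on 1 U f -> U x ->
  {for (x, h), continuous (fun p : E * E => 'D_(p.2) f p.1)}.
Proof.
move=> oU [_ _ /= cf] Ux.
have oUT : open (U `*` [set: E]) by apply: openX => //; exact: openT.
move: cf; rewrite continuous_open_subspace// => /(_ (x, h)); apply.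
by rewrite inE.
Qed.

Lemma norm_pair_lt E V (x : E) (y : V) (d : R) :
  `|x| < d -> `|y| < d -> `|(x, y)| < d.
Proof. by move=> xd yd; rewrite prod_normE/= gt_max xd. Qed.

(* The constant comes from the continuity at [((x, 0), (0, 0))] of the second
   derivative, which vanishes there, and from the homogeneity of the
   derivatives in their directions. *)
Lemma Ck_on_derive_lipschitz E V (U : set E) (f : E -> V) (x : E) :
  open U -> Ck_on 2 U f -> U x -> exists2 r : R, 0 < r & exists2 K : R, 0 < K &
    forall y, `|y - x| < r -> U y /\
    forall h, `|'D_h f y - 'D_h f x| <= K * `|y - x| * `|h|.
Proof.
move=> oU [cf df ddf] Ux.
set F := fun p : E * E => 'D_(p.2) f p.1.
have oUT : open (U `*` [set: E]) by apply: openX => //; exact: openT.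
have cF : {for ((x, 0 : E), (0 : E * E)),
    continuous (fun p : (E * E) * (E * E) => 'D_(p.2) F p.1)}.
  exact: Ck_on_derive_continuous oUT ddf _.
have [_ dF _] := ddf.
have /near_normP[r1 r10 r1P] : \forall P \near ((x, 0 : E), (0 : E * E)),
    `|'D_(P.2) F P.1| < 1.
  have /cvgrPdist_lt/(_ 1 ltr01) := cF; apply: filterS => P.
  by rewrite derive0 sub0r normrN.
have /near_normP[r2 r20 r2P] : \forall y \near x, U y by exact: open_nbhs_nbhs.
pose r := Num.min r1 r2.
have r0 : 0 < r by rewrite lt_min r10.
have rr1 z : z < r -> z < r1 by rewrite lt_min => /andP[].
have rr2 z : z < r -> z < r2 by rewrite lt_min => /andP[].
have rP y h k : `|y - x| < r -> `|h| < r -> `|k| < r ->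
    `|'D_(k, 0) F (y, h)| <= 1.
  move=> yr hr kr; apply/ltW.
  have := r1P ((y, h), (k, 0 : E)); apply.
  have -> : ((y, h), (k, 0 : E)) - ((x, 0 : E), (0 : E * E)) =
      ((y - x, h), (k, 0 : E)).
    by congr ((_, _), (_, _)); rewrite ?subr0.
  by apply/rr1; do ?apply: norm_pair_lt; rewrite ?normr0.
(* Rescaling [z] to a vector [k] of norm [r / 2] costs the factor [c], proportional to [|z|];
   homogeneity then carries bounds on small directions over to all directions. *)
have half z : z != 0 -> exists2 c : R, 0 < c &
    exists2 k : E, `|k| < r & z = c *: k /\ c = 2 / r * `|z|.
  move=> z0; have zp : 0 < `|z| by rewrite normr_gt0.
  have c0 : 0 < 2 / r * `|z| by rewrite mulr_gt0// divr_gt0.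
  exists (2 / r * `|z|) => //; exists ((2 / r * `|z|)^-1 *: z).
    rewrite normrZ gtr0_norm ?invr_gt0// invfM invf_div.
    by rewrite -mulrA mulVf ?gt_eqF// mulr1 ltr_pdivrMr// ltr_pMr// ltr1n.
  by rewrite scalerA divff ?gt_eqF// scale1r.
(* Mean value estimate for [F] in its first argument with [h] fixed; the derivative in direction
   [(y - x, 0)] is [c] times one bounded by 1. *)
have claim1 y h : `|y - x| < r -> `|h| < r ->
    `|F (y, h) - F (x, h)| <= 2 / r * `|y - x|.
  move=> yr hr; have [->|yx] := eqVneq y x;
    first by rewrite !subrr !normr0 mulr0.
  have [c c0 [k kr [ykc cE]]] := half (y - x) ltac:(by rewrite subr_eq0).
  rewrite -[F (y, h) - _]subr0 -cE.
  have -> : (y, h) = (x, h) + (y - x, 0).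
    by rewrite /= [RHS]/(_ + _)/=; congr (_, _);
      rewrite /= ?addr0// addrC subrK.
  have sg s : (x, h) + s *: (y - x, 0 : E) = (x + s *: (y - x), h).
    by rewrite [LHS]/(_ + _)/=; congr (_, _); rewrite /= ?scaler0 ?addr0.
  have sr s : 0 <= s <= 1 -> `|x + s *: (y - x) - x| < r.
    move=> /andP[s0 s1]; rewrite addrC addKr normrZ ger0_norm//.
    by apply: le_lt_trans yr; rewrite ler_piMl.
  have sU s : 0 <= s <= 1 -> (U `*` setT) (x + s *: (y - x), h).
    by move=> /sr/rr2/r2P ?; split.
  apply: segment_increment_le => s s01; rewrite sg; first exact: dF (sU s s01).
  rewrite subr0.
  have -> : (y - x, 0 : E) = c *: (k, 0 : E).
    by rewrite [RHS]/(_ *: _)/=; congr (_, _); rewrite ?scaler0// ykc.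
  rewrite derive_scale; last exact: dF (sU s s01).
  rewrite normrZ gtr0_norm//; apply: ler_piMr; first exact: ltW.
  by apply: rP => //; exact: sr.
(* One factor [2 / r] comes from rescaling [y - x], the other from rescaling [h]. *)
exists r => //; exists ((2 / r) ^+ 2); first by rewrite exprn_gt0// divr_gt0.
move=> y yr; have Uy : U y by apply/r2P/rr2.
split=> // h; have [->|h0] := eqVneq h 0.
  by rewrite !derive0 subrr !normr0 mulr0.
have [c c0 [k kr [hE cE]]] := half h h0.
have := claim1 y k yr kr; rewrite /F/= => /(ler_wpM2l (ltW c0)) A.
rewrite [in leLHS]hE !derive_scale; [|exact: df..].
rewrite -scalerBr normrZ (gtr0_norm c0) (le_trans A)//.
by rewrite le_eqVlt cE; apply/orP; left; apply/eqP; ring.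
Qed.

(** On the segment from [q] to [p], which stays in the ball around [x], the derivative in direction
    [p - q] differs from its value at [x] by at most [K * r * |p - q|]; hence the radius is taken at
    most [e / K]. *)
Lemma Ck_on_strict E V (U : set E) (f : E -> V) (x : E) :
  open U -> Ck_on 2 U f -> U x -> forall e : R, 0 < e -> exists2 r : R, 0 < r &
  forall p q, `|p - x| < r -> `|q - x| < r ->
    `|f p - f q - 'D_(p - q) f x| <= e * `|p - q|.
Proof.
move=> oU Cf Ux e e0; have [_ df _] := Cf.
have [r r0 [K K0 rP]] := Ck_on_derive_lipschitz oU Cf Ux.
exists (Num.min r (e / K)); first by rewrite lt_min r0 divr_gt0.
move=> p q; rewrite !lt_min => /andP[pr pe] /andP[qr qe].
have sr (a : R) s : `|p - x| < a -> `|q - x| < a -> 0 <= s <= 1 ->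
    `|q + s *: (p - q) - x| < a.
  move=> pa qa /andP[s0 s1].
  have -> : q + s *: (p - q) - x = s *: (p - x) + (1 - s) *: (q - x).
    rewrite scalerBl scale1r addrCA -scalerBr opprB addrA subrK.
    by rewrite addrAC.
  rewrite (le_lt_trans (ler_normD _ _))// !normrZ !ger0_norm ?subr_ge0//.
  have : Num.max `|p - x| `|q - x| < a by rewrite gt_max pa.
  apply: le_lt_trans; set m := Num.max _ _.
  have -> : m = s * m + (1 - s) * m by rewrite -mulrDl addrC subrK mul1r.
  by rewrite lerD// ler_wpM2l ?subr_ge0// le_max lexx ?orbT.
have -> : f p = f (q + (p - q)) by rewrite addrC subrK.
apply: segment_increment_le => s s01.
  by apply: df; have [] := rP _ (sr _ _ pr qr s01).
have [_ /(_ (p - q))/le_trans->//] := rP _ (sr _ _ pr qr s01).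
apply: ler_wpM2r => //; rewrite mulrC -ler_pdivlMr//.
exact/ltW/sr.
Qed.

(** The secant slope [k] of [y] tends to [w]. On the segment from [y 0] to [y t] the derivative in
    direction [t *: k] is [t] times a value of the differential near [(y 0, w)], so joint continuity
    and the mean value estimate suffice. *)
Lemma is_derive_comp_curve E V (U : set E) (f : E -> V) (y : R -> E) (w : E) :
  open U -> Ck_on 1 U f -> U (y 0) -> is_derive (0 : R) 1 y w ->
  is_derive (0 : R) 1 (f \o y) ('D_w f (y 0)).
Proof.
move=> oU Cf Uy /is_deriveP dy; apply/is_deriveP => e e0; have [_ df _] := Cf.
have e20 : 0 < e / 2 by rewrite divr_gt0.
have cf := Ck_on_derive_continuous oU Cf Uy.
have /near_normP[r1 r10 r1P] : \forall P \near (y 0, w),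
    `|'D_(P.2) f P.1 - 'D_w f (y 0)| < e.
  by have /cvgrPdist_lt/(_ e e0) := cf w; apply: filterS => P; rewrite distrC.
have /near_normP[r2 r20 r2P] :
    \forall z \near y 0, U z by exact: open_nbhs_nbhs.
pose r := Num.min r1 r2.
have r0 : 0 < r by rewrite lt_min r10.
have rr1 z : z < r -> z < r1 by rewrite lt_min => /andP[].
have rr2 z : z < r -> z < r2 by rewrite lt_min => /andP[].
have rw : 0 < r + `|w| + 1 by rewrite ltr_wpDl// addr_ge0// ltW.
have small : \forall t \near (0 : R), `|t| < r / (r + `|w| + 1).
  by apply: nbhs0_lt; rewrite divr_gt0.
near=> t.
have [->|t0] := eqVneq t 0.
  by rewrite scale0r addr0 subrr scale0r subr0 !normr0 mulr0.
rewrite add0r [t *: 1]mulr1 /=.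
set k := t^-1 *: (y t - y 0).
have ky : y t = y 0 + t *: k by rewrite scalerA divff// scale1r addrC subrK.
have kw : `|k - w| < r.
  have : `|y (0 + t *: 1) - y 0 - t *: w| <= r / 2 * `|t|.
    by near: t; apply: dy; rewrite divr_gt0.
  rewrite add0r [t *: 1]mulr1 ky (addrAC (y 0)) subrr add0r -scalerBr normrZ mulrC.
  rewrite ler_pM2r ?normr_gt0// => /le_lt_trans; apply.
  by rewrite gtr_pMr// invf_lt1// ltr1n.
have tk : `|t *: k| < r.
  have kb : `|k| <= r + `|w|.
    by rewrite -[k](subrK w) (le_trans (ler_normD _ _))// lerD// ltW.
  rewrite normrZ.
  have : `|t| < r / (r + `|w| + 1) by near: t; exact: small.
  rewrite ltr_pdivlMr//; apply: le_lt_trans; apply: ler_wpM2l => //.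
  by rewrite (le_trans kb)// lerDl.
have sr s : 0 <= s <= 1 -> `|y 0 + s *: (t *: k) - y 0| < r.
  move=> /andP[s0 s1]; rewrite addrC addKr normrZ ger0_norm//.
  by apply: le_lt_trans tk; rewrite ler_piMl.
rewrite ky; apply: segment_increment_le => s /sr ys.
  by apply: df; exact/r2P/rr2.
rewrite derive_scale; last by apply: df; exact/r2P/rr2.
rewrite -scalerBr normrZ mulrC ler_wpM2r// ltW//.
apply: (r1P (_, k)); apply/rr1.
rewrite [X in `|X|]/(_ + _)/=; exact: norm_pair_lt.
Unshelve. all: by end_near. Qed.

(** The map [T y = y + (z - f y)] contracts by one half and preserves the closed ball of radius
    [rho] around [w]; its fixed point solves [f y = z]. *)
Lemma near_identity_surj (E : completeNormedModType R) (f : E -> E)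
    (w z : E) (rho : R) : 0 < rho ->
  (forall y y', `|y - w| <= rho -> `|y' - w| <= rho ->
    `|f y - f y' - (y - y')| <= 2^-1 * `|y - y'|) ->
  `|z - f w| <= 2^-1 * rho -> exists2 y, `|y - w| <= rho & f y = z.
Proof.
move=> rho0 fP zw.
pose T y := y + (z - f y).
have BE : closed_ball w rho = [set y | `|y - w| <= rho].
  rewrite closed_ballE//; apply/seteqP; split=> y /=;
    by rewrite /closed_ball_/= distrC.
have Tc y y' : `|y - w| <= rho -> `|y' - w| <= rho ->
    `|T y - T y'| <= 2^-1 * `|y - y'|.
  move=> yw y'w; rewrite distrC.
  have -> : T y' - T y = f y - f y' - (y - y').
    by rewrite /T opprD addrACA addrC (opprB z) (addrC (z - _)) subrKA opprB.
  exact: fP.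
have wB : `|w - w| <= rho by rewrite subrr normr0 ltW.
have TB y : `|y - w| <= rho -> `|T y - w| <= rho.
  move=> yw; rewrite -[T y - w](subrKA (T w)) (le_trans (ler_normD _ _))//.
  have -> : rho = 2^-1 * rho + 2^-1 * rho by rewrite -mulrDl; lra.
  rewrite lerD//; first by rewrite (le_trans (Tc _ _ yw wB))// ler_wpM2l.
  by rewrite /T addrAC subrr add0r.
have TU : set_fun (closed_ball w rho) (closed_ball w rho) T.
  by rewrite BE => y; exact: TB.
have half0 : 0 <= 2^-1 :> R by rewrite invr_ge0.
have [||y yB yT] := @banach_fixed_point R E (closed_ball w rho) (mkfun_fun TU) _
  (@closed_ball_closed _ _ _ _).
- exists (NngNum half0); split; first by rewrite /= invf_lt1// ltr1n.
  have inB y : closed_ball w rho y -> `|y - w| <= rho by rewrite BE.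
  by move=> [y y'] [/= /inB yw /inB y'w]; exact: Tc.
- by exists w; rewrite BE.
exists y; first by move: yB; rewrite BE.
move: yT => /eqP; rewrite /= /mkfun /T -subr_eq0 opprD addNKr.
by rewrite oppr_eq0 subr_eq0 => /eqP.
Qed.

End Calculus.

(** * Charts, and the group operations read in them *)

Section Charts.
Set Implicit Arguments.
Unset Strict Implicit.
Context {R : realType} {E : completeNormedModType R} {G : banachLieGroupType E}.
Implicit Types (c d e : chart E G) (g h : G).

Lemma chart_imP c z : chart_im c z ->
  chart_dom c (chart_inv c z) /\ c (chart_inv c z) = z.
Proof. by move=> [g cg <-]; rewrite chart_funK ?inE. Qed.

Lemma chart_funE c g : chart_dom c g -> chart_inv c (c g) = g.
Proof. by move=> cg; rewrite chart_funK ?inE. Qed.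

Lemma chart_im_fun c g : chart_dom c g -> chart_im c (c g).
Proof. by exists g. Qed.

Lemma chart_fun_cvg c g : chart_dom c g -> {for g, continuous c}.
Proof.
move=> cg; have := @chart_fun_continuous _ _ _ c.
rewrite continuous_open_subspace; last exact: chart_dom_open.
by apply; rewrite inE.
Qed.

Lemma chart_inv_cvg c z : chart_im c z -> {for z, continuous (chart_inv c)}.
Proof.
move=> cz; have := @chart_inv_continuous _ _ _ c.
rewrite continuous_open_subspace; last exact: chart_im_open.
by apply; rewrite inE.
Qed.

Lemma near_chart_dom c g : chart_dom c g -> \forall h \near g, chart_dom c h.
Proof. by move=> cg; apply: open_nbhs_nbhs; split => //;
  exact: chart_dom_open. Qed.

Lemma near_chart_im c z : chart_im c z -> \forall y \near z, chart_im c y.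
Proof. by move=> cz; apply: open_nbhs_nbhs; split => //;
  exact: chart_im_open. Qed.

Lemma mulg_cvg (T : Type) (F : set_system T) `{Filter T F} (f k :
    T -> G) (a b : G) :
  f @ F --> a -> k @ F --> b -> (fun t => f t * k t)%g @ F --> (a * b)%g.
Proof.
move=> fa kb; apply: (cvg_comp (fun t => (f t, k t)) (fun p : G * G => (p.1 * p.2)%g)).
  exact: cvg_pair fa kb.
exact: (@lie_mul_continuous R E G (a, b)).
Qed.

Lemma invg_cvg (T : Type) (F : set_system T) `{Filter T F} (f : T -> G) (a :
    G) :
  f @ F --> a -> (fun t => (f t)^-1)%g @ F --> (a^-1)%g.
Proof.
by move=> fa; apply: (cvg_comp f (fun g : G => (g^-1)%g)) fa
  (@lie_inv_continuous R E G a).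
Qed.

Definition chart_mul c d e (p : E * E) : E :=
  e (chart_inv c p.1 * chart_inv d p.2)%g.

Definition chart_mul_dom c d e : set (E * E) :=
  [set p : E * E | [/\ chart_im c p.1, chart_im d p.2
        & chart_dom e (chart_inv c p.1 * chart_inv d p.2)%g]].

Lemma chart_mul_dom_open c d e : open (chart_mul_dom c d e).
Proof.
rewrite openE => -[p q] [/= cp dq epq]; rewrite /interior.
have cvp : chart_inv c x.1 @[x --> (p, q)] --> chart_inv c p.
  apply: (cvg_comp fst (chart_inv c)) (chart_inv_cvg cp); exact: cvg_fst.
have cvq : chart_inv d x.2 @[x --> (p, q)] --> chart_inv d q.
  apply: (cvg_comp snd (chart_inv d)) (chart_inv_cvg dq); exact: cvg_snd.
have N3 : \forall x \near (p, q),
    chart_dom e (chart_inv c x.1 * chart_inv d x.2)%g.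
  exact: (mulg_cvg cvp cvq (near_chart_dom epq)).
have N1 : \forall x \near (p, q), chart_im c x.1.
  exact: cvg_fst (near_chart_im cp).
have N2 : \forall x \near (p, q), chart_im d x.2.
  exact: cvg_snd (near_chart_im dq).
by apply: filterS3 N1 N2 N3 => x; split.
Qed.

Lemma chart_mul_smooth c d e : atlas c -> atlas d -> atlas e ->
  smooth_on (chart_mul_dom c d e) (chart_mul c d e).
Proof. by move=> ac ad ae; exact: lie_mul_smooth. Qed.

End Charts.

(** * First-order behaviour of the exponential function and of the multiplication near 1 *)

Section Exponential.
Set Implicit Arguments.
Unset Strict Implicit.
Context {R : realType} {E : completeNormedModType R} {G : banachLieGroupType E}.
Context {c0 : chart E G} {expG : E -> G}.
Hypotheses (c0_atlas : atlas c0) (c0_at1 : chart_dom c0 1%g).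
Hypothesis expG_exp : exponential_function c0 expG.

Local Notation p0 := (c0 1%g).
Local Notation m := (chart_mul c0 c0 c0).

Lemma exp0 : expG 0 = 1%g.
Proof.
have := exp_one_param expG_exp 0 0 0; rewrite addr0 scale0r => h.
by apply: (@mulgI G (expG 0)); rewrite mulg1.
Qed.

Lemma expN x : expG (- x) = ((expG x)^-1)%g.
Proof.
apply/esym/mulg1_eq; have := exp_one_param expG_exp x 1 (-1).
by rewrite subrr scale0r exp0 scaleN1r scale1r.
Qed.

Lemma is_derive_exp0 (h : E) : is_derive (0 : E) h (c0 \o expG) h.
Proof.
apply/is_deriveP => e e0.
have /is_deriveP/(_ e e0) := exp_velocity expG_exp h; apply: filterS => t.
by rewrite !add0r [t *: 1]mulr1 scale0r.
Qed.

Lemma near_exp_dom : \forall x \near (0 : E), chart_dom c0 (expG x).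
Proof. by apply: (exp_continuous expG_exp); rewrite exp0;
  exact: near_chart_dom. Qed.

(** Strict differentiability at 0, where the differential of [c0 \o expG] is the identity. *)
Lemma exp_strict (e : R) : 0 < e -> exists2 r : R, 0 < r &
  forall x y, `|x| < r -> `|y| < r -> chart_dom c0 (expG x) /\
    `|c0 (expG x) - c0 (expG y) - (x - y)| <= e * `|x - y|.
Proof.
move=> e0; have [r1 r10 r1P] := (near_normP _ _).1 near_exp_dom.
have oU : open (expG @^-1` chart_dom c0).
  by apply: open_comp (chart_dom_open c0) => x _;
    exact: (exp_continuous expG_exp).
have U0 : (expG @^-1` chart_dom c0) 0 by rewrite /= exp0.
have [r r0 rP] := Ck_on_strict oU (exp_smooth expG_exp c0_atlas 2%N) U0 e0.
exists (Num.min r r1); first by rewrite lt_min r0.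
move=> x y; rewrite !lt_min => /andP[xr xr1] /andP[yr yr1].
split; first by apply: r1P; rewrite subr0.
have := rP x y; rewrite !subr0 => /(_ xr yr).
by rewrite (@derive_val _ _ _ _ _ _ _ (is_derive_exp0 _)).
Qed.

Lemma near_chart_mul_dom : \forall p \near (p0, p0), chart_mul_dom c0 c0 c0 p.
Proof.
apply: open_nbhs_nbhs; split; first exact: chart_mul_dom_open.
by split; rewrite /= ?chart_funE// ?mulg1//; exact: chart_im_fun.
Qed.

(** Since [m (p0, q) = q] near [p0], the increment is exactly [t *: k]. *)
Lemma is_derive_mul0 (k : E) : is_derive (p0, p0) (0 : E, k) m k.
Proof.
apply/is_deriveP => e e0.
have [r r0 rP] := (near_normP _ _).1 (near_chart_im (chart_im_fun c0_at1)).
have [d d0 dP] : exists2 d : R, 0 < d & forall t, `|t| < d -> `|t *: k| < r.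
  exists (r / (`|k| + 1)); first by rewrite divr_gt0// ltr_wpDl.
  move=> t; rewrite ltr_pdivlMr ?ltr_wpDl// => td; rewrite normrZ.
  by apply: le_lt_trans td; rewrite ler_wpM2l// lerDl.
apply/near_normP; exists d => // t; rewrite subr0 => /dP tk.
have -> : (p0, p0) + t *: (0 : E, k) = (p0, p0 + t *: k).
  by rewrite [LHS]/(_ + _)/=; congr (_, _); rewrite /= scaler0 addr0.
rewrite /chart_mul/= !chart_funE// !mul1g.
have [_ ->] : chart_dom c0 (chart_inv c0 (p0 + t *: k)) /\
    c0 (chart_inv c0 (p0 + t *: k)) = p0 + t *: k.
  by apply: chart_imP; apply: rP; rewrite addrAC subrr add0r.
by rewrite (addrAC p0) subrr add0r subrr normr0 mulr_ge0// ltW.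
Qed.

(** Left translations by elements near 1, read in the chart, differ from the identity by maps of
    small Lipschitz constant, uniformly in the translating element. *)
Lemma mul_strict (e : R) : 0 < e -> exists2 r : R, 0 < r &
  forall p q q', `|p - p0| < r -> `|q - p0| < r -> `|q' - p0| < r ->
    chart_mul_dom c0 c0 c0 (p, q) /\
    `|m (p, q) - m (p, q') - (q - q')| <= e * `|q - q'|.
Proof.
move=> e0; have [r1 r10 r1P] := (near_normP _ _).1 near_chart_mul_dom.
have [r r0 rP] := Ck_on_strict (@chart_mul_dom_open _ _ _ c0 c0 c0)
  (chart_mul_smooth c0_atlas c0_atlas c0_atlas 2%N)
  (nbhs_singleton near_chart_mul_dom) e0.
exists (Num.min r r1); first by rewrite lt_min r0.
move=> p q q'; rewrite !lt_min => /andP[pr pr1] /andP[qr qr1] /andP[q'r q'r1].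
split; first by apply: r1P; exact: norm_pair_lt.
have := rP (p, q) (p, q') (norm_pair_lt pr qr) (norm_pair_lt pr q'r).
have -> : (p, q) - (p, q') = (0, q - q') by congr (_, _); rewrite /= subrr.
rewrite (@derive_val _ _ _ _ _ _ _ (is_derive_mul0 _)).
by rewrite prod_normE/= normr0 max_r.
Qed.

Lemma mul_p0r p : chart_im c0 p -> m (p, p0) = p.
Proof.
by move=> /chart_imP[_ cp]; rewrite /chart_mul/= chart_funE// mulg1.
Qed.

Lemma near_curve (f : R -> G) (P : set G) : f 0 = 1%g ->
  {for 0, continuous f} -> (\forall g \near 1%g, P g) ->
  \forall t \near (0 : R), P (f t).
Proof. by move=> <- cf; exact: cf. Qed.

Lemma chart_curve_cvg (f : R -> G) : f 0 = 1%g -> {for 0, continuous f} ->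
  c0 \o f @ (0 : R) --> p0.
Proof.
by move=> f0 cf; apply: (cvg_comp f c0) cf _; rewrite f0; exact: chart_fun_cvg.
Qed.

(** By [mul_strict] with [q' = p0], the product read in the chart moves away from [c0 (f t)] by
    [c0 (k t) - p0] up to a small multiple of that vector, so velocities at 1 add. *)
Lemma is_derive_mul_curves (f k : R -> G) (x y : E) : f 0 = 1%g -> k 0 = 1%g ->
  {for 0, continuous f} -> {for 0, continuous k} ->
  is_derive (0 : R) 1 (c0 \o f) x -> is_derive (0 : R) 1 (c0 \o k) y ->
  is_derive (0 : R) 1 (fun t => c0 (f t * k t)%g) (x + y).
Proof.
move=> f0 k0 cf ck /is_deriveP df /is_deriveP dk; apply/is_deriveP => e e0.
(* The error is [a * (1 + |y|) * |t|] from the multiplication, where [a <= 1] is used to bound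
   [c0 (k t) - p0], plus [a * |t|] from each of the two curves. *)
pose a := Num.min 1 (e / (3 + `|y|)).
have a0 : 0 < a by rewrite lt_min ltr01 divr_gt0// ltr_wpDr.
have a1 : a <= 1 by rewrite ge_min lexx.
have ae : a * (3 + `|y|) <= e.
  by rewrite -ler_pdivlMr ?ltr_wpDr// ge_min lexx orbT.
have [r r0 rP] := mul_strict a0.
have near_p0 (l : R -> G) : l 0 = 1%g -> {for 0, continuous l} ->
    \forall t \near (0 : R), chart_dom c0 (l t) /\ `|c0 (l t) - p0| < r.
  move=> l0 cl.
  have N1 : \forall t \near (0 : R), chart_dom c0 (l t).
    exact: near_curve l0 cl (near_chart_dom c0_at1).
  have N2 : \forall t \near (0 : R), `|c0 (l t) - p0| < r.
    have := chart_curve_cvg l0 cl.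
    by move=> /cvgrPdist_lt/(_ r r0); apply: filterS => t; rewrite distrC.
  by apply: filterS2 N1 N2.
near=> t.
have [ft fr] : chart_dom c0 (f t) /\ `|c0 (f t) - p0| < r.
  by near: t; exact: near_p0.
have [kt kr] : chart_dom c0 (k t) /\ `|c0 (k t) - p0| < r.
  by near: t; exact: near_p0.
have dft : `|c0 (f t) - p0 - t *: x| <= a * `|t|.
  have : `|c0 (f (0 + t *: 1)) - c0 (f 0) - t *: x| <= a * `|t|.
    by near: t; exact: df.
  by rewrite add0r [t *: 1]mulr1 f0.
have dkt : `|c0 (k t) - p0 - t *: y| <= a * `|t|.
  have : `|c0 (k (0 + t *: 1)) - c0 (k 0) - t *: y| <= a * `|t|.
    by near: t; exact: dk.
  by rewrite add0r [t *: 1]mulr1 k0.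
have p0r : `|p0 - p0| < r by rewrite subrr normr0.
have [_] := rP _ _ _ fr kr p0r.
rewrite mul_p0r; last exact: chart_im_fun.
rewrite /chart_mul/= !chart_funE// => mt.
have kb : `|c0 (k t) - p0| <= (1 + `|y|) * `|t|.
  rewrite -[c0 (k t) - p0](subrK (t *: y)) (le_trans (ler_normD _ _))//.
  rewrite mulrDl lerD//; last by rewrite normrZ mulrC.
  by rewrite (le_trans dkt)// ler_wpM2r.
rewrite add0r [t *: 1]mulr1 f0 k0 mulg1.
set A := c0 (f t * k t)%g in mt *.
have -> : A - p0 - t *: (x + y) = (A - c0 (f t) - (c0 (k t) - p0)) +
    ((c0 (f t) - p0 - t *: x) + (c0 (k t) - p0 - t *: y)).
  rewrite scalerDr opprD (addrACA (c0 (f t) - p0)) [RHS]addrA; congr (_ + _).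
  by rewrite (addrC (c0 (f t) - p0)) subrKA subrKA.
have dd := le_trans (ler_normD _ _) (lerD dft dkt).
apply: le_trans (le_trans (ler_normD _ _) (lerD mt dd)) _.
apply: (@le_trans _ _ (a * (3 + `|y|) * `|t|)); last by rewrite ler_wpM2r.
by have := ler_wpM2l (ltW a0) kb; lra.
Unshelve. all: by end_near. Qed.

(** With [w = s *: a], the map [y |-> expG (- w) * expG y] in the chart sends [w] to [p0] and is
    close to a translation. By [near_identity_surj] the image of the ball of radius [s * r] around
    [w] contains the ball of half that radius around [p0]; then [x = s^-1 *: y]. *)
Lemma exp_quotients_cover (a : E) (r : R) : 0 < r ->
  exists2 s0 : R, 0 < s0 & forall (s : R) z, 0 < s < s0 ->
    `|z - p0| <= 2^-1 * (s * r) ->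
    exists2 x, `|x - a| <= r & chart_inv c0 z = (expG (- s *: a) * expG (s *: x))%g.
Proof.
(* The errors of [expG] and of the multiplication combine to [1/8 + 1/8 * (1 + 1/8)], which is below
   [1/2]. *)
move=> r0; have e80 : 0 < 8^-1 :> R by rewrite invr_gt0.
have [r1 r10 r1P] := exp_strict e80.
have [r2 r20 r2P] := mul_strict e80.
pose r3 := Num.min r1 (2^-1 * r2).
have r30 : 0 < r3 by rewrite lt_min r10 mulr_gt0// invr_gt0.
have eP y : `|y| < r3 -> [/\ `|y| < r1, chart_dom c0 (expG y)
    & `|c0 (expG y) - p0| < r2].
  rewrite lt_min => /andP[yr1 yr2].
  have := r1P y 0; rewrite normr0 => /(_ yr1 r10)[dy].
  rewrite exp0 subr0 => A; split => //.
  rewrite -[_ - p0](subrK y) (le_lt_trans (ler_normD _ _))//.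
  by have := normr_ge0 y; lra.
have ar0 : 0 < `|a| + r by rewrite ltr_wpDl.
(* Points of the ball of radius [s * r] around [s *: a] have norm at most [s * (|a| + r)], which
   must stay below [r3]. *)
exists (r3 / (`|a| + r)); first by rewrite divr_gt0.
move=> s z /andP[s0]; rewrite ltr_pdivlMr// => sr3 zs.
set w := s *: a; pose f y := m (c0 (expG (- w)), c0 (expG y)).
have small y : `|y - w| <= s * r -> `|y| < r3.
  move=> yw; apply: le_lt_trans sr3; rewrite -[y](subrK w).
  rewrite (le_trans (ler_normD _ _))// addrC mulrDr lerD//.
  by rewrite normrZ gtr0_norm.
have sr0 : 0 < s * r by rewrite mulr_gt0.
have wr3 : `|w| < r3 by apply: small; rewrite subrr normr0 ltW.
have [_ dw wr2] : [/\ `|- w| < r1, chart_dom c0 (expG (- w))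
    & `|c0 (expG (- w)) - p0| < r2] by apply: eP; rewrite normrN.
have fw : f w = p0.
  have [_ dw' _] := eP _ wr3.
  by rewrite /f /chart_mul/= !chart_funE// expN mulVg.
have [||y yw fy] := @near_identity_surj _ _ f w z (s * r) sr0.
- move=> y y' /small/eP[yr1 dy yr2] /small/eP[y'r1 dy' y'r2].
  have [_ A] := r2P _ _ _ wr2 yr2 y'r2.
  have [_ B] := r1P _ _ yr1 y'r1.
  have C : `|c0 (expG y) - c0 (expG y')| <= (1 + 8^-1) * `|y - y'|.
    rewrite -[_ - c0 _](subrK (y - y')) (le_trans (ler_normD _ _))//.
    by have := normr_ge0 (y - y'); lra.
  rewrite -[_ - (y - y')](subrKA (c0 (expG y) - c0 (expG y'))).
  rewrite (le_trans (ler_normD _ _))// (le_trans (lerD A B))//.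
  by have := normr_ge0 (y - y'); lra.
- by rewrite fw.
exists (s^-1 *: y).
  have -> : s^-1 *: y - a = s^-1 *: (y - w).
    by rewrite scalerBr scalerA mulVf ?gt_eqF// scale1r.
  by rewrite normrZ gtr0_norm ?invr_gt0// ler_pdivrMl.
rewrite scalerA divff ?gt_eqF// scale1r scaleNr -/w -fy /f /chart_mul/=.
have [_ dy yr2] := eP _ (small _ yw).
have [[_ _ d3] _] := r2P _ _ _ wr2 yr2 yr2.
rewrite /= (chart_funE dw) (chart_funE dy) in d3 *.
by rewrite chart_funE.
Qed.

Lemma exp_curve (x : E) : [/\ expG ((0 : R) *: x) = 1%g,
  {for (0 : R), continuous (fun t : R => expG (t *: x))} &
  is_derive (0 : R) 1 (c0 \o (fun t : R => expG (t *: x))) x].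
Proof.
split; first by rewrite scale0r exp0.
  apply: (@cvg_comp _ _ _ (fun t : R => t *: x) expG); last first.
    exact: (exp_continuous expG_exp).
  exact: (@scalel_continuous R E x 0).
exact: exp_velocity expG_exp x.
Qed.

End Exponential.

(** * The orbit map of a vector of [D_Lie], first at 1 and then in arbitrary charts, and the two
    inclusions *)

Section Representation.
Set Implicit Arguments.
Unset Strict Implicit.
Context {R : realType} {E V : completeNormedModType R} {G : banachLieGroupType E}.
Context {c0 : chart E G} {expG : E -> G} (pi : G -> {linear V -> V}).
Hypotheses (c0_atlas : atlas c0) (c0_at1 : chart_dom c0 1%g).
Hypothesis expG_exp : exponential_function c0 expG.
Hypothesis pi_repr : representation pi.
Hypothesis pi_cont : continuous (fun p : G * V => pi p.1 p.2).

Local Notation p0 := (c0 1%g).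

Lemma repr_cvg (T : Type) (F : set_system T) `{Filter T F} (f : T -> G) (k :
    T -> V)
    (g : G) (u : V) :
  f @ F --> g -> k @ F --> u -> (fun t => pi (f t) (k t)) @ F --> pi g u.
Proof.
move=> fg ku.
apply: (cvg_comp (fun t => (f t, k t)) (fun p : G * V => pi p.1 p.2)).
  exact: cvg_pair fg ku.
exact: (@pi_cont (g, u)).
Qed.

(** Continuity of the action at [(g0, 0)] bounds [pi g] on a ball of radius [d], uniformly for [g]
    near [g0]; scaling extends the bound to all [u]. *)
Lemma repr_bounded (g0 : G) : exists2 M : R, 0 < M &
  \forall g \near g0, forall u, `|pi g u| <= M * `|u|.
Proof.
have := @pi_cont (g0, 0); rewrite /continuous_at/= linear0.
move=> /cvgrPdist_lt/(_ 1 ltr01)[[A B] [/= nA nB] AB].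
have [d d0 dB] := (near_normP _ _).1 nB.
exists (2 / d); first by rewrite divr_gt0.
apply: filterS nA => g Ag u.
have [->|u0] := eqVneq u 0; first by rewrite linear0 !normr0 mulr0.
have up : 0 < `|u| by rewrite normr_gt0.
pose c := 2 / d * `|u|.
have c0' : 0 < c by rewrite mulr_gt0// divr_gt0.
have -> : u = c *: (c^-1 *: u) by rewrite scalerA divff ?gt_eqF// scale1r.
rewrite linearZ/= normrZ gtr0_norm// scalerA divff ?gt_eqF// scale1r.
rewrite ler_piMr ?ltW//.
have : (A `*` B) (g, c^-1 *: u).
  split=> //=; apply: dB; rewrite subr0 normrZ gtr0_norm ?invr_gt0// /c invfM.
  by rewrite -mulrA mulVf ?gt_eqF// mulr1 invf_div ltr_pdivrMr// ltr_pMr// ltr1n.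
by move=> /AB/=; rewrite sub0r normrN.
Qed.

(** The derived representation, applied to [v]; the value is meaningful when [v] lies in
    [D_at expG x]. *)
Definition drepr (v : V) (x : E) : V :=
  'D_1 (fun t : R => pi (expG (t *: x)) v) 0.

Lemma D_LieP v : D_Lie pi expG v <->
  forall x, is_derive (0 : R) 1 (fun t : R => pi (expG (t *: x)) v) (drepr v x).
Proof.
split=> [Dv x|Dv x _]; first by apply: DeriveDef => //; exact: Dv.
by have [] := Dv x.
Qed.

Lemma drepr_bound v x (e : R) :
    D_Lie pi expG v -> 0 < e -> \forall t \near (0 : R),
  `|pi (expG (t *: x)) v - v - t *: drepr v x| <= e * `|t|.
Proof.
move=> /D_LieP/(_ x)/is_deriveP/[apply]; apply: filterS => t.
by rewrite add0r [t *: 1]mulr1 scale0r (exp0 expG_exp) (repr1 pi_repr).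
Qed.

(** The closed sets [A n] cover [E] because each orbit curve is differentiable at 0. If none
    contained a ball, their complements would be open and dense, and Baire would give a point
    outside all of them. *)
Lemma uniform_ball v : D_Lie pi expG v -> exists (a : E) (r K : R),
  [/\ 0 < r, 0 < K & forall x, `|x - a| <= r ->
    forall t : R, `|t| <= K^-1 -> `|pi (expG (t *: x)) v - v| <= K * `|t|].
Proof.
move=> Dv; pose A (n : nat) := [set x | forall t : R, `|t| <= n.+1%:R^-1 ->
  `|pi (expG (t *: x)) v - v| <= n.+1%:R * `|t|].
apply: contrapT => noball.
have cA n : closed (A n).
  have -> : A n = \bigcap_(t in [set t : R | `|t| <= n.+1%:R^-1])
      [set x | `|pi (expG (t *: x)) v - v| <= n.+1%:R * `|t|] by [].
  apply: closed_bigI => t _.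
  apply: (@preimage_closed _ _ (fun x : E => `|pi (expG (t *: x)) v - v|)
    [set y | y <= n.+1%:R * `|t|]); last exact: closed_le.
  move=> x _; apply: cvg_norm; apply: cvgB; last exact: cvg_cst.
  apply: repr_cvg; last exact: cvg_cst.
  apply: (@cvg_comp _ _ _ (fun x : E => t *: x) expG).
    exact: scaler_continuous.
  exact: (exp_continuous expG_exp).
have := @Baire R E (fun n => ~` A n).
have oA n : open (~` A n) /\ dense (~` A n).
  split; first by rewrite openC.
  move=> O [y Oy] oO; apply: contrapT => OA; apply: noball.
  have [d d0 dO] : exists2 d : R, 0 < d & forall z, `|z - y| < d -> O z.
    by apply/near_normP; apply: open_nbhs_nbhs.
  exists y, (d / 2), n.+1%:R; split; rewrite ?divr_gt0//.
  move=> x xy t tn; apply: contrapT => ngt; apply: OA; exists x; split.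
    by apply: dO; rewrite (le_lt_trans xy)// gtr_pMr// invf_lt1// ltr1n.
  by move=> /(_ t tn).
move=> /(_ oA setT); rewrite setTI => /(_ (ex_intro _ 0 I) openT)[x xA].
have /near_normP[d d0 dP] := drepr_bound x Dv ltr01.
(* [n.+1] exceeds [d^-1], so the times allowed in [A n] lie within [d] of 0, and also the slope
   [1 + |drepr v x|]; hence [x] lies in [A n], a contradiction. *)
pose n := Num.truncn (Num.max d^-1 (1 + `|drepr v x|)).
have : Num.max d^-1 (1 + `|drepr v x|) < n.+1%:R by exact: truncnS_gt.
rewrite gt_max => /andP[dn vn].
apply: (xA n I) => t tn.
have := dP t; rewrite subr0 mul1r => /(_ _)/=.
have td : `|t| < d by rewrite (le_lt_trans tn)// invf_plt// posrE.
move=> /(_ td) vt.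
rewrite -[_ - v](subrK (t *: drepr v x)) (le_trans (ler_normD _ _))//.
rewrite (le_trans (lerD vt (lexx _)))// normrZ -[X in X + _]mulr1 -mulrDr mulrC.
by rewrite ler_wpM2r// ltW.
Qed.

(** Near [p0], [chart_inv c0 z] is a product [expG (- s *: a) * expG (s *: x)] with [s] proportional
    to [|z - p0|]. Each factor moves [v] by at most [K * s], and the left one has operator bound
    [M]. *)
Lemma orbit_lipschitz v : D_Lie pi expG v -> exists2 K : R, 0 < K &
  \forall z \near p0, `|pi (chart_inv c0 z) v - v| <= K * `|z - p0|.
Proof.
move=> /uniform_ball[a [r [K [r0 K0 aP]]]].
have [s0 s00 s0P] := exp_quotients_cover c0_atlas c0_at1 expG_exp a r0.
have [M M0 /= MP] := repr_bounded 1%g.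
have [s1 s10 s1P] : exists2 s1 : R, 0 < s1 & forall s : R, `|s| < s1 ->
    forall u, `|pi (expG (s *: a)) u| <= M * `|u|.
  have [e1 ce _] := exp_curve expG_exp a.
  have /near_normP[s1 s10 s1P] := near_curve e1 ce MP; exists s1 => // s ss.
  by apply: s1P; rewrite subr0.
pose s2 := Num.min s0 (Num.min s1 K^-1).
have s20 : 0 < s2 by rewrite !lt_min s00 s10 invr_gt0.
exists ((M + 1) * K * (2 / r)).
  by rewrite mulr_gt0 ?divr_gt0// mulr_gt0// addr_gt0.
apply/near_normP; exists (2^-1 * (s2 * r));
  first by rewrite !mulr_gt0// invr_gt0.
move=> z zs; have [->|zp] := eqVneq z p0.
  by rewrite chart_funE// (repr1 pi_repr) !subrr !normr0 mulr0.
(* This [s] makes [|z - p0|] equal to the covered radius [s * r / 2]; it is positive since [z]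
   differs from [p0]. *)
pose s := 2 / r * `|z - p0|.
have sp : 0 < s by rewrite mulr_gt0 ?divr_gt0// normr_gt0 subr_eq0.
have ss2 : s < s2.
  by rewrite /s mulrAC ltr_pdivrMr// mulrC -ltr_pdivlMr// mulrC.
move: ss2; rewrite !lt_min => /and3P[ss0 ss1 sK].
have [||x xa ->] := s0P s z.
- by rewrite sp.
- by rewrite /s mulrAC divfK ?gt_eqF// mulKf.
rewrite (reprM pi_repr).
have -> : pi (expG (- s *: a)) (pi (expG (s *: x)) v) - v =
    pi (expG (- s *: a)) (pi (expG (s *: x)) v - v) + (pi (expG (- s *: a)) v - v).
  by rewrite linearB/= addrA subrK.
have bx := aP x xa s; rewrite gtr0_norm// in bx.
(* The uniform estimate at the centre [a] and time [- s] controls the left factor. *)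
have aa : `|a - a| <= r by rewrite subrr normr0 ltW.
have ba := aP a aa (- s); rewrite normrN gtr0_norm// in ba.
have bM := s1P (- s); rewrite normrN gtr0_norm// in bM.
rewrite (le_trans (ler_normD _ _))//.
apply: le_trans (lerD (bM ss1 _) (ba (ltW sK))) _.
apply: le_trans (lerD (ler_wpM2l (ltW M0) (bx (ltW sK))) (lexx _)) _.
by rewrite le_eqVlt /s; apply/orP; left; apply/eqP; ring.
Qed.

(** The quotient curve [eta t = expG (- t x) * gam t] has velocity 0, so the Lipschitz estimate
    makes [pi (eta t) v - v] of order [o(t)]; applying the locally bounded operators
    [pi (expG (t *: x))] keeps this order. *)
Lemma is_derive_orbit_curve v (gam : R -> G) (x : E) : D_Lie pi expG v ->
  gam 0 = 1%g -> {for 0, continuous gam} ->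
  is_derive (0 : R) 1 (c0 \o gam) x ->
  is_derive (0 : R) 1 (fun t => pi (gam t) v) (drepr v x).
Proof.
move=> Dv g0 cg dg.
have [K K0 KP] := orbit_lipschitz Dv.
have [M M0 MP] := repr_bounded 1%g.
have [e0 ce de] := exp_curve expG_exp x.
have [n0 cn dn] := exp_curve expG_exp (- x).
pose eta t := (expG (t *: - x) * gam t)%g.
have eta0 : eta 0 = 1%g by rewrite /eta n0 g0 mulg1.
have ceta : {for 0, continuous eta} by exact: mulg_cvg cn cg.
have /is_deriveP deta : is_derive (0 : R) 1 (c0 \o eta) 0.
  by rewrite -(addNr x); exact: is_derive_mul_curves.
have N1 : \forall t \near (0 : R), chart_dom c0 (eta t).
  exact: near_curve eta0 ceta (near_chart_dom c0_at1).
have N2 : \forall t \near (0 :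
    R), `|pi (eta t) v - v| <= K * `|c0 (eta t) - p0|.
  have := chart_curve_cvg c0_at1 eta0 ceta KP; apply: filterS2 N1 => t et /=.
  by rewrite chart_funE.
have N3 : \forall t \near (0 :
    R), forall u, `|pi (expG (t *: x)) u| <= M * `|u|.
  exact: near_curve e0 ce MP.
apply/is_deriveP => a a0.
pose b := a / (M * K + 1).
have MK0 : 0 < M * K + 1 by rewrite addr_gt0// mulr_gt0.
have b0 : 0 < b by rewrite divr_gt0.
have N4 := deta b b0.
have N5 := drepr_bound x Dv b0.
have N12 : \forall t \near (0 : R), `|pi (eta t) v - v| <= K * (b * `|t|).
  apply: filterS2 N2 N4 => t A B; rewrite (le_trans A)// ler_wpM2l ?(ltW K0)//.
  by move: B; rewrite add0r [t *: 1]mulr1 scaler0 subr0 /= eta0.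
apply: filterS3 N12 N3 N5 => t A B C.
rewrite add0r [t *: 1]mulr1 g0 (repr1 pi_repr).
have -> : gam t = (expG (t *: x) * eta t)%g.
  by rewrite /eta scalerN (expN expG_exp) mulgA mulgV mul1g.
rewrite (reprM pi_repr).
have -> : pi (expG (t *: x)) (pi (eta t) v) - v - t *: drepr v x =
    pi (expG (t *: x)) (pi (eta t) v - v) +
    (pi (expG (t *: x)) v - v - t *: drepr v x).
  by rewrite linearB/= [RHS]addrA [X in _ = X - _]addrA subrK.
rewrite (le_trans (ler_normD _ _))// (le_trans (lerD (B _) C))//.
rewrite (le_trans (lerD (ler_wpM2l (ltW M0) A) (lexx _)))//.
have -> : M * (K * (b * `|t|)) + b * `|t| = b * (M * K + 1) * `|t| by ring.
by rewrite /b divfK ?gt_eqF.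
Qed.

(** The curve [expG (t *: x) * expG (t *: y)] has velocity [x + y], so its orbit derivative is
    [drepr v (x + y)]; expanding [pi g (pi h v)] directly gives the sum. *)
Lemma dreprD v x y : D_Lie pi expG v -> drepr v (x + y) = drepr v x + drepr v y.
Proof.
move=> Dv.
have [x0 cx dx] := exp_curve expG_exp x.
have [y0 cy dy] := exp_curve expG_exp y.
have dxy := is_derive_mul_curves c0_atlas c0_at1 x0 y0 cx cy dx dy.
have cxy : {for (0 : R), continuous (fun t :
    R => expG (t *: x) * expG (t *: y))%g}.
  exact: mulg_cvg cx cy.
have xy0 : (expG ((0 : R) *: x) * expG ((0 : R) *: y))%g = 1%g.
  by rewrite x0 y0 mulg1.
have dv := is_derive_orbit_curve Dv xy0 cxy dxy.
rewrite -(@derive_val _ _ _ _ _ _ _ dv); apply: derive_val.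
have [M M0 MP] := repr_bounded 1%g.
have N1 : \forall t \near (0 :
    R), forall u, `|pi (expG (t *: x)) u| <= M * `|u|.
  exact: near_curve x0 cx MP.
apply/is_deriveP => a a0.
(* The errors are [M * b] from the expansion in [y] moved by [pi g], [b] from replacing
   [pi g (drepr v y)] by [drepr v y], and [b] from the expansion in [x]. *)
pose b := a / (M + 2).
have M20 : 0 < M + 2 by rewrite addr_gt0.
have b0 : 0 < b by rewrite divr_gt0.
have N2 := drepr_bound x Dv b0.
have N3 := drepr_bound y Dv b0.
have N4 : \forall t \near (0 :
    R), `|pi (expG (t *: x)) (drepr v y) - drepr v y| <= b.
  have : pi (expG (t *: x)) (drepr v y) @[t --> (0 : R)] --> drepr v y.
    rewrite -[X in _ --> X](repr1 pi_repr) -x0.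
    by apply: repr_cvg => //; exact: cvg_cst.
  by move=> /cvgrPdist_le/(_ b b0); apply: filterS => t; rewrite distrC.
near=> t.
have B1 : forall u, `|pi (expG (t *: x)) u| <= M * `|u| by near: t.
have B2 : `|pi (expG (t *: x)) v - v - t *: drepr v x| <= b * `|t| by near: t.
have B3 : `|pi (expG (t *: y)) v - v - t *: drepr v y| <= b * `|t| by near: t.
have B4 : `|pi (expG (t *: x)) (drepr v y) - drepr v y| <= b by near: t.
rewrite add0r [t *: 1]mulr1 x0 y0 mulg1 (repr1 pi_repr) (reprM pi_repr).
set g := expG (t *: x); set h := expG (t *: y).
have -> : pi g (pi h v) - v - t *: (drepr v x + drepr v y) =
    pi g (pi h v - v - t *: drepr v y) + (t *: (pi g (drepr v y) - drepr v y)
    + (pi g v - v - t *: drepr v x)).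
  have pB u w : pi g (u - w) = pi g u - pi g w by exact: linearB.
  have pZ u : pi g (t *: u) = t *: pi g u by exact: linearZ.
  rewrite !pB pZ scalerBr scalerDr.
  set A := t *: drepr v x; set B := t *: drepr v y; set C := t *: pi g _.
  rewrite [RHS]addrA subrKA (addrAC _ _ (- B)) -(addrA (pi g v)) subrKA.
  by rewrite opprD !addrA (addrAC _ (- B)) (addrAC _ (- B)).
have A1 : `|pi g (pi h v - v - t *: drepr v y)| <= M * (b * `|t|).
  exact: le_trans (B1 _) (ler_wpM2l (ltW M0) B3).
have A2 : `|t *: (pi g (drepr v y) - drepr v y)| <= `|t| * b.
  by rewrite normrZ ler_wpM2l.
rewrite (le_trans (ler_normD _ _))//.
apply: le_trans (lerD A1 (le_trans (ler_normD _ _) (lerD A2 B2))) _.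
have -> : M * (b * `|t|) + (`|t| * b + b * `|t|) = b * (M + 2) * `|t| by ring.
by rewrite /b divfK ?gt_eqF.
Unshelve. all: by end_near. Qed.

(** The Lipschitz estimate of the orbit map along [expG (t *: x)] gives [|drepr v x| <= K * |x|];
    additivity turns this into a bound on differences. *)
Lemma drepr_lipschitz v : D_Lie pi expG v ->
  exists2 K : R, 0 < K & forall x y, `|drepr v x - drepr v y| <= K * `|x - y|.
Proof.
move=> Dv.
have [K K0 KP] := orbit_lipschitz Dv.
have bnd x : `|drepr v x| <= K * `|x|.
  have [x0 cx dx] := exp_curve expG_exp x.
  apply/ler_addgt0Pr => e e0.
  (* After division by [t], the orbit curve contributes the error [b] and the chart curve
     [K * b]. *)
  pose b := e / (K + 1).
  have K10 : 0 < K + 1 by rewrite addr_gt0.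
  have b0 : 0 < b by rewrite divr_gt0.
  have /is_deriveP/(_ b b0) N1 := dx.
  have N2 := drepr_bound x Dv b0.
  have N3 : \forall t \near (0 : R), chart_dom c0 (expG (t *: x)).
    exact: near_curve x0 cx (near_chart_dom c0_at1).
  have N4 : \forall t \near (0 : R),
      `|pi (expG (t *: x)) v - v| <= K * `|c0 (expG (t *: x)) - p0|.
    have := chart_curve_cvg c0_at1 x0 cx KP; apply: filterS2 N3 => t et /=.
    by rewrite chart_funE.
  have [d d0 dP] := (near_normP _ _).1 (filterI N1 (filterI N2 N4)).
  pose t := d / 2.
  have t0 : 0 < t by rewrite divr_gt0.
  have := dP t; rewrite subr0 gtr0_norm// gtr_pMr// invf_lt1// ltr1n => /(_ isT).
  rewrite /= add0r [t *: 1]mulr1 x0 => -[A [B C]].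
  have A' : `|c0 (expG (t *: x)) - p0| <= b * t + t * `|x|.
    rewrite -[_ - p0](subrK (t *: x)) (le_trans (ler_normD _ _))// lerD//.
      by rewrite gtr0_norm in A.
    by rewrite normrZ gtr0_norm.
  have : t * `|drepr v x| <= b * t + K * (b * t + t * `|x|).
    rewrite -{1}(gtr0_norm t0) -normrZ.
    rewrite -[t *: drepr v x](subKr (pi (expG (t *: x)) v - v)).
    rewrite (le_trans (ler_normB _ _))// [leRHS]addrC lerD//.
      by rewrite (le_trans C)// ler_wpM2l// ltW.
    by rewrite gtr0_norm in B.
  have -> : b * t + K * (b * t + t * `|x|) = t * (K * `|x| + b * (K + 1)) by ring.
  by rewrite ler_pM2l// /b divfK ?gt_eqF.
exists K => // x y.
by rewrite -{1}(subrK y x) dreprD// addrK.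
Qed.

Lemma drepr_continuous v : D_Lie pi expG v -> continuous (drepr v).
Proof.
move=> /drepr_lipschitz[K K0 KP] x; apply/cvgrPdist_lt => e e0.
apply/near_normP; exists (e / K); first by rewrite divr_gt0.
move=> y; rewrite ltr_pdivlMr// mulrC => yx.
by rewrite (le_lt_trans (KP _ _))// distrC.
Qed.

(* The velocity at [t = 0], read in the chart [c0], of the curve
   [t |-> g^-1 * chart_inv c (z + t *: h)] for [g = chart_inv c z]; here [d] is
   any chart around [g^-1]. *)
Definition left_velocity (c d : chart E G) (z h : E) : E :=
  'D_((0, h) : E * E) (chart_mul d c c0) (d ((chart_inv c z)^-1)%g, z).

Lemma chart_mul_dom_invl (c d : chart E G) z : chart_im c z ->
  chart_dom d ((chart_inv c z)^-1)%g ->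
  chart_mul_dom d c c0 (d ((chart_inv c z)^-1)%g, z).
Proof.
by move=> cz dz; split; rewrite /= ?chart_funE ?mulVg//; exact: chart_im_fun.
Qed.

(** With [g = chart_inv c z], the orbit along [z + t *: h] is [pi g] applied to the orbit along
    [gam], a curve through 1 with velocity [left_velocity c d z h]; the bounded operator [pi g]
    preserves the derivative. *)
Lemma is_derive_orbit_chart v (c d : chart E G) (z h : E) : D_Lie pi expG v ->
  atlas c -> atlas d -> chart_im c z -> chart_dom d ((chart_inv c z)^-1)%g ->
  is_derive z h ((fun g => pi g v) \o chart_inv c)
    (pi (chart_inv c z) (drepr v (left_velocity c d z h))).
Proof.
move=> Dv ac ad cz dz; set g := chart_inv c z.
pose gam (t : R) := (g^-1 * chart_inv c (z + t *: h))%g.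
have gam0 : gam 0 = 1%g by rewrite /gam scale0r addr0 mulVg.
have lin_cvg : z + t *: h @[t --> (0 : R)] --> z.
  rewrite -[X in _ --> X]addr0 -(scale0r h); apply: cvgD; first exact: cvg_cst.
  exact: scalel_continuous.
have cgam : {for 0, continuous gam}.
  apply: mulg_cvg; first exact: cvg_cst.
  rewrite scale0r addr0.
  by apply: (cvg_comp (fun t :
      R => z + t *: h) (chart_inv c)) lin_cvg (chart_inv_cvg cz).
have [_ dmul _] := chart_mul_smooth ad ac c0_atlas 1%N.
have /is_deriveP dgam : is_derive (0 : R) 1 (c0 \o gam) (left_velocity c d z h).
  apply/is_deriveP => e e0.
  have /is_deriveP/(_ e e0) : is_derive (d (g^-1)%g, z) (0 : E, h)
      (chart_mul d c c0) (left_velocity c d z h).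
    by apply: DeriveDef => //; apply: dmul; exact: chart_mul_dom_invl.
  apply: filterS => t; rewrite add0r [t *: 1]mulr1 /= gam0.
  have -> : (d (g^-1)%g, z) + t *: (0 : E, h) = (d (g^-1)%g, z + t *: h).
    by rewrite [LHS]/(_ + _)/=; congr (_, _); rewrite /= scaler0 addr0.
  by rewrite /chart_mul/= !chart_funE// mulVg.
have /is_deriveP dpi := is_derive_orbit_curve Dv gam0 cgam ((is_deriveP _ _ _ _).2 dgam).
have [M M0 /nbhs_singleton MP] := repr_bounded g.
apply/is_deriveP => e e0; have eM : 0 < e / M by rewrite divr_gt0.
apply: filterS (dpi _ eM) => t;
  rewrite add0r [t *: 1]mulr1 gam0 (repr1 pi_repr) => A.
set w := drepr v _ in A *.
have -> : ((fun g => pi g v) \o chart_inv c) (z + t *: h) -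
    ((fun g => pi g v) \o chart_inv c) z - t *: pi g w =
    pi g (pi (gam t) v - v - t *: w).
  have pB u u' : pi g (u - u') = pi g u - pi g u' by exact: linearB.
  have pZ u : pi g (t *: u) = t *: pi g u by exact: linearZ.
  by rewrite !pB pZ -(reprM pi_repr) /gam mulgA mulgV mul1g.
by rewrite (le_trans (MP _))// -ler_pdivlMl// mulrA (mulrC M^-1).
Qed.

(** The derivative formula in a chart is built from the action, [drepr v] and the differential of
    the multiplication, all continuous, hence it is jointly continuous in point and direction. *)
Lemma D_Lie_sub_C1 v : D_Lie pi expG v -> C1_vectors pi v.
Proof.
move=> Dv c ac.
have oc : open (chart_im c) by exact: chart_im_open.
have inv_chart z : exists2 d :
    chart E G, atlas d & chart_dom d ((chart_inv c z)^-1)%g.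
  by have [d ad dz] := @atlas_cover R E G ((chart_inv c z)^-1)%g; exists d.
have cvg_inv z : chart_im c z -> chart_inv c y @[y --> z] --> chart_inv c z.
  exact: chart_inv_cvg.
split.
- rewrite continuous_open_subspace// => z; rewrite inE => cz.
  by apply: repr_cvg => //; [exact: cvg_inv|exact: cvg_cst].
- move=> z h cz; have [d ad dz] := inv_chart z.
  by have [] := is_derive_orbit_chart h Dv ac ad cz dz.
- have ocT : open (chart_im c `*` [set: E]) by apply: openX => //; exact: openT.
  rewrite /= continuous_open_subspace// => -[z h]; rewrite inE => -[/= cz _].
  have [d ad dz] := inv_chart z.
  have cvgz : chart_inv c p.1 @[p --> (z, h)] --> chart_inv c z.
    by apply: (cvg_comp fst (chart_inv c)) (cvg_inv _ cz); exact: cvg_fst.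
  have cvgV : ((chart_inv c p.1)^-1)%g @[p --> (z, h)] --> ((chart_inv c z)^-1)%g.
    exact: invg_cvg cvgz.
  have N1 : \forall p \near (z, h), chart_im c p.1.
    exact: cvg_fst (near_chart_im cz).
  have N2 : \forall p \near (z, h), chart_dom d ((chart_inv c p.1)^-1)%g.
    exact: (cvgV _ (near_chart_dom dz)).
  (* One chart [d] serves for all points near [z], so the formula may replace the derivative in the
     limit at [(z, h)]. *)
  have N : \forall p \near (z, h),
      pi (chart_inv c p.1) (drepr v (left_velocity c d p.1 p.2)) =
      'D_(p.2) ((fun g => pi g v) \o chart_inv c) p.1.
    apply: filterS2 N1 N2 => -[y k] /= cy dy.
    by have [_ ->] := is_derive_orbit_chart k Dv ac ad cy dy.
  suff : (fun p : E * E => 'D_(p.2) ((fun g => pi g v) \o chart_inv c) p.1) @ (z, h)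
      --> pi (chart_inv c z) (drepr v (left_velocity c d z h)).
    by rewrite (nbhs_singleton N).
  apply: (cvg_trans (near_eq_cvg N)).
  apply: repr_cvg => //.
  apply: (@cvg_comp _ _ _ (fun p :
      E * E => left_velocity c d p.1 p.2) (drepr v));
    last exact: drepr_continuous.
  have cmul := Ck_on_derive_continuous (x := (d ((chart_inv c z)^-1)%g, z))
    (h := (0 : E, h))
    (@chart_mul_dom_open _ _ _ d c c0)
    (chart_mul_smooth ad ac c0_atlas 1%N) (chart_mul_dom_invl cz dz).
  have cvgd : d ((chart_inv c p.1)^-1)%g @[p --> (z, h)] --> d ((chart_inv c z)^-1)%g.
    exact: (cvg_comp _ _ cvgV (chart_fun_cvg dz)).
  have cvg1 : (d ((chart_inv c p.1)^-1)%g, p.1) @[p --> (z, h)] -->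
      (d ((chart_inv c z)^-1)%g, z).
    by apply: cvg_pair cvgd _; exact: cvg_fst.
  have cvg2 : ((0 : E, p.2) : E * E) @[p --> (z, h)] --> ((0, h) : E * E).
    by apply: (@cvg_pair _ _ _ _ (nbhs (0 : E)) (nbhs h));
      [exact: cvg_cst|exact: cvg_snd].
  exact: (cvg_comp _ _ (cvg_pair cvg1 cvg2) cmul).
Qed.

(** The chain rule along the one-parameter group read in [c0], which stays in the chart domain for
    small [t]. *)
Lemma C1_sub_D_Lie v : C1_vectors pi v -> D_Lie pi expG v.
Proof.
move=> C1v x _.
have [x0 cx dx] := exp_curve expG_exp x.
have ez : (c0 \o (fun t : R => expG (t *: x))) 0 = p0 by rewrite /= x0.
have im0 : chart_im c0 ((c0 \o (fun t : R => expG (t *: x))) 0).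
  by rewrite ez; exact: chart_im_fun.
have /is_deriveP dF := is_derive_comp_curve (chart_im_open c0) (C1v c0 c0_atlas) im0 dx.
suff : is_derive (0 : R) 1 (fun t : R => pi (expG (t *: x)) v)
  ('D_x ((fun g => pi g v) \o chart_inv c0) p0) by case.
apply/is_deriveP => e e0; have := dF e e0.
have := near_curve x0 cx (near_chart_dom c0_at1).
apply: filterS2 => t et; rewrite /= add0r [t *: 1]mulr1 x0.
by rewrite !chart_funE.
Qed.

End Representation.

Theorem theorem8p5 (R : realType) (E V : completeNormedModType R)
    (G : banachLieGroupType E)
    (c0 : chart E G) (c0_atlas : atlas c0) (c0_at1 : chart_dom c0 1%g)
    (expG : E -> G) (expG_exp : exponential_function c0 expG)
    (pi : G -> {linear V -> V}) (pi_repr : representation pi)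
    (pi_cont : continuous (fun p : G * V => pi p.1 p.2)) :
  D_Lie pi expG = C1_vectors pi.
Proof.
apply/seteqP; split=> v.
  exact: (D_Lie_sub_C1 c0_atlas c0_at1 expG_exp pi_repr pi_cont).
exact: (C1_sub_D_Lie c0_atlas c0_at1 expG_exp).
Qed.
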